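(* Let $X:=\ell_{2}=\{(x_{n})_{n\geq1}\subset\mathbb{R}\mid\sum_{n\geq1}x_{n}^{2}<\infty\}$ be endowed with its usual norm, let $\overline{x}:=(n^{-1})_{n\geq1}\in\ell_{2}$, let $C:=[0,1]\overline{x}=\{t\overline{x}\mid t\in[0,1]\}\subset\ell_{2}$, and let $D:=\ell_{1}^{+}:=\{(x_{n})_{n\geq1}\subset\mathbb{R}_{+}\mid\sum_{n\geq1}x_{n}<\infty\}\subset\ell_{2}$. Then $C$ and $D$ are convex sets, $$\operatorname{qri}C=\operatorname{icr}C=(0,1)\overline{x}=\{t\overline{x}\mid t\in(0,1)\},$$ $$\operatorname{qri}D=\operatorname{qi}D=\{(x_{n})_{n\geq1}\in\ell_{1}\mid x_{n}>0\ \ \forall n\geq1\},$$ and $$\overline{x}\in\operatorname{qi}(C+D)=\operatorname{qri}(C+D),\qquad\text{but}\qquad \overline{x}\notin C+\operatorname{qi}D\supset\operatorname{qri}C+\operatorname{qri}D.$$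
   Context: Here $\ell_1$ is the set of absolutely summable real sequences, regarded as a linear subspace of $\ell_2$, and $\mathbb{R}_+=[0,\infty)$. All topological notions are with respect to the norm topology of $X=\ell_2$. For a set $A\subset X$, $\operatorname{cone}A$ denotes the conic hull of $A$, containing $0$ by convention; for convex $A\neq\emptyset$ it is $\{ta \mid t\ge 0,\ a\in A\}$. Its closure is denoted $\overline{\operatorname{cone}}A$. For a convex set $A\subset X$, the quasi interior of $A$ is $$\operatorname{qi}A:=\{x\in A\mid \overline{\operatorname{cone}}(A-x)=X\},$$ and the quasi relative interior of $A$ is $$\operatorname{qri}A:=\{x\in A\mid \overline{\operatorname{cone}}(A-x)\text{ is a linear subspace of }X\}.$$ The intrinsic core $\operatorname{icr}A$ is the set of $a\in A$ such that for every $y$ in the affine hull of $A$ there is $\delta>0$ with $a+t(y-a)\in A$ for all $t\in[0,\delta]$. For $A,B\subset X$, $A+B:=\{a+b\mid a\in A,\ b\in B\}$. The inclusion sign $\supset$ allows equality. *)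

(* Defs.v *)
From HB Require Import structures.
From mathcomp Require Import all_boot all_order all_algebra.
From mathcomp Require Import all_classical all_reals all_analysis.
From mathcomp Require Import ring lra.

Set Implicit Arguments.
Unset Strict Implicit.
Unset Printing Implicit Defensive.

Import Order.TTheory GRing.Theory Num.Theory.
Import numFieldNormedType.Exports.

Local Open Scope classical_set_scope.
Local Open Scope ring_scope.

Section ConvexAnalysis.
Context {R : realType} {V : normedModType R}.
Implicit Types (A B : set V) (x y : V).

Definition sumset A B : set V := [set a + b | a in A & b in B].

(* For convex [A] this is the convex conic hull; the union with [set 0] only
   matters for [A = set0]. *)
Definition cone A : set V := [set 0] `|` [set t *: a | t in `[0, +oo[ & a in A].

Definition linear_subspace A : Prop := submod_closed [in A].

Definition affine_set A : Prop :=
  forall x y (t : R), A x -> A y -> A ((1 - t) *: x + t *: y).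

Definition aff A : set V := smallest affine_set A.

Definition qi A : set V :=
  [set x | A x /\ closure (cone [set a - x | a in A]) = setT].

Definition qri A : set V :=
  [set x | A x /\ linear_subspace (closure (cone [set a - x | a in A]))].

Definition icr A : set V :=
  [set a | A a /\ forall y, aff A y ->
     exists2 d : R, 0 < d & forall t, 0 <= t <= d -> A (a + t *: (y - a))].

End ConvexAnalysis.

Section SummableSequences.
Context {R : realType}.
Implicit Types (u v : R^nat).

Definition abs_summable u : Prop := cvgn (series (fun n => `|u n|)).

Definition square_summable u : Prop := cvgn (series (fun n => u n ^+ 2)).

Lemma series_ge0_le_lim u n : (forall n, 0 <= u n) ->
  cvgn (series u) -> series u n <= limn (series u).
Proof.
move=> u0 cu; apply: nondecreasing_cvgn_le => //.
by apply: nondecreasing_series => k _ _; exact: u0.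
Qed.

Lemma square_summable0 : square_summable 0.
Proof.
rewrite /square_summable (_ : (fun n => _) = 0); last first.
  by apply/funext => n; rewrite expr0n.
rewrite (_ : series 0 = cst 0); first exact: is_cvg_cst.
by apply/funext => n; rewrite /series /= big1.
Qed.

Lemma square_summableD u v :
  square_summable u -> square_summable v -> square_summable (u + v).
Proof.
move=> cu cv.
pose w := (2 : R) *: (fun n => u n ^+ 2) + (2 : R) *: (fun n => v n ^+ 2).
apply: (@series_le_cvg _ _ w) => [n|n|n|].
- exact: sqr_ge0.
- by rewrite addr_ge0 // mulr_ge0 // sqr_ge0.
- rewrite /w !fctE /= /GRing.scale /=; have := sqr_ge0 (u n - v n); lra.
- by apply: is_cvg_seriesD; apply: is_cvg_seriesZ.
Qed.

Lemma square_summableZ (a : R) u :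
  square_summable u -> square_summable (a *: u).
Proof.
move=> cu; rewrite /square_summable.
rewrite (_ : (fun n => _) = a ^+ 2 *: (fun n => u n ^+ 2)).
  exact: is_cvg_seriesZ.
by apply/funext => n; rewrite !fctE /= exprMn.
Qed.

Lemma abs_summable_square u : abs_summable u -> square_summable u.
Proof.
move=> su; set M := limn (series (fun n => `|u n|)).
have uM n : `|u n| <= M.
  apply: (@le_trans _ _ (series (fun n => `|u n|) n.+1)).
    by rewrite seriesSr lerDr sumr_ge0.
  exact: series_ge0_le_lim.
have M0 : 0 <= M by exact: le_trans (uM 0%N).
apply: (@series_le_cvg _ _ (M *: (fun n => `|u n|))) => [n|n|n|].
- exact: sqr_ge0.
- by rewrite mulr_ge0.
- by rewrite fctE -real_normK ?num_real // expr2 ler_wpM2r.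
- exact: is_cvg_seriesZ.
Qed.

Lemma square_summable_harmonic : square_summable (@harmonic R).
Proof.
apply: nondecreasing_is_cvgn.
  by apply: nondecreasing_series => n _ _; exact: sqr_ge0.
exists 2 => _ [n _ <-].
suff h : series (fun n => harmonic n ^+ 2) n.+1 <= 2 - n.+1%:R^-1 :> R.
  apply: (@le_trans _ _ (2 - n.+1%:R^-1)); last by rewrite gerBl invr_ge0.
  by apply: le_trans h; rewrite /series /= big_nat_recr //= lerDl sqr_ge0.
elim: n => [|n IH]; first by rewrite /series /= big_nat1 invr1 expr1n; lra.
rewrite /series /= big_nat_recr //=.
apply: le_trans (lerD IH (lexx _)) _.
have a0 : 0 < n.+1%:R :> R by rewrite ltr0n.
rewrite -[n.+2]addn1 natrD; move: (n.+1%:R : R) a0 => a a0.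
rewrite -subr_ge0.
have -> : 2 - (a + 1)^-1 - (2 - a^-1 + (a + 1)^-1 ^+ 2)
  = a^-1 * (a + 1)^-1 ^+ 2 by field; apply/andP; split; lra.
by rewrite mulr_ge0 // ?sqr_ge0 // invr_ge0 ltW.
Qed.

End SummableSequences.

Definition ell2_pred (R : realType) : {pred R^nat} :=
  mem [set u : R^nat | square_summable u].

Lemma ell2_submod_closed (R : realType) : submod_closed (@ell2_pred R).
Proof.
split=> [|a u v]; rewrite !inE /=; first exact: square_summable0.
by move=> su sv; apply: square_summableD => //; apply: square_summableZ.
Qed.

HB.instance Definition _ (R : realType) :=
  GRing.isSubmodClosed.Build R (R^nat) (@ell2_pred R) (@ell2_submod_closed R).

(* Sequences are indexed from 0: the [n]-th coordinate of [x : ell2 R] is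
   $x_{n+1}$. *)
Record ell2 (R : realType) := Ell2 {
  ell2_val :> nat -> R ;
  ell2_valP : ell2_val \in @ell2_pred R }.

Section Ell2.
Context {R : realType}.
Implicit Types x y : ell2 R.

HB.instance Definition _ := [isSub for @ell2_val R].
HB.instance Definition _ := [Choice of ell2 R by <:].
HB.instance Definition _ := [SubChoice_isSubLmodule of ell2 R by <:].

Definition ell2_norm x : R := Num.sqrt (limn (series (fun n => x n ^+ 2))).

Lemma ell2_cvg x : cvgn (series (fun n => x n ^+ 2)).
Proof. by case: x => u /=; rewrite inE. Qed.

Lemma ell2_series_le x n :
  series (fun n => x n ^+ 2) n <= limn (series (fun n => x n ^+ 2)).
Proof.
by apply: series_ge0_le_lim; [move=> k; exact: sqr_ge0 | exact: ell2_cvg].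
Qed.

Lemma ell2_lim_ge0 x : 0 <= limn (series (fun n => x n ^+ 2)).
Proof.
by have := ell2_series_le x 0%N; rewrite {1}/series /= big_geq.
Qed.

Lemma ell2_norm_sqr x : ell2_norm x ^+ 2 = limn (series (fun n => x n ^+ 2)).
Proof. by rewrite sqr_sqrtr // ell2_lim_ge0. Qed.

Lemma ell2_norm_eq0 x : ell2_norm x = 0 -> x = 0.
Proof.
move=> nx; have lx : limn (series (fun n => x n ^+ 2)) = 0.
  by rewrite -ell2_norm_sqr nx expr0n.
apply/val_inj/funext => n /=; apply/eqP; rewrite -sqrf_eq0 eq_le sqr_ge0 andbT.
rewrite -lx; apply: le_trans (ell2_series_le x n.+1).
by rewrite /series /= big_nat_recr //= lerDr sumr_ge0 // => i _; exact: sqr_ge0.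
Qed.

Lemma ell2_normZ (a : R) x : ell2_norm (a *: x) = `|a| * ell2_norm x.
Proof.
rewrite /ell2_norm.
have -> : (fun n => (a *: x) n ^+ 2) = a ^+ 2 *: (fun n => x n ^+ 2).
  by apply/funext => n; rewrite !fctE /= exprMn.
rewrite lim_seriesZ; last exact: ell2_cvg.
by rewrite sqrtrM ?sqr_ge0 // sqrtr_sqr.
Qed.

Lemma ell2_ler_normD x y : ell2_norm (x + y) <= ell2_norm x + ell2_norm y.
Proof.
have [/ell2_norm_eq0 ->|a0] := eqVneq (ell2_norm x) 0.
  by rewrite add0r lerDr sqrtr_ge0.
have [/ell2_norm_eq0 ->|b0] := eqVneq (ell2_norm y) 0.
  by rewrite addr0 lerDl sqrtr_ge0.
have {}a0 : 0 < ell2_norm x by rewrite lt_neqAle eq_sym a0 sqrtr_ge0.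
have {}b0 : 0 < ell2_norm y by rewrite lt_neqAle eq_sym b0 sqrtr_ge0.
have := ell2_norm_sqr x; have := ell2_norm_sqr y.
move: (ell2_norm x) (ell2_norm y) a0 b0 => a b a0 b0 sb sa.
have ab0 : 0 <= a + b by rewrite addr_ge0 // ltW.
rewrite -[leRHS]ger0_norm // -sqrtr_sqr ler_wsqrtr //.
pose w := (1 + b / a) *: (fun n => x n ^+ 2) + (1 + a / b) *: (fun n => y n ^+ 2).
have cx := @ell2_cvg x; have cy := @ell2_cvg y.
have -> : (a + b) ^+ 2 = limn (series w).
  rewrite lim_seriesD; [|exact: is_cvg_seriesZ..].
  rewrite !lim_seriesZ //.
  rewrite -sa -sb /GRing.scale /=; field.
  by rewrite !gt_eqF.
apply: lim_series_le; first exact: ell2_cvg.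
  by apply: is_cvg_seriesD; exact: is_cvg_seriesZ.
move=> n; rewrite /w !fctE /= /GRing.scale /= !fctE.
rewrite -subr_ge0.
have -> : (1 + b / a) * x n ^+ 2 + (1 + a / b) * y n ^+ 2 - (x n + y n) ^+ 2
  = (b * x n - a * y n) ^+ 2 / (a * b) by field; rewrite !gt_eqF.
by rewrite mulr_ge0 ?sqr_ge0 // invr_ge0 mulr_ge0 // ltW.
Qed.

HB.instance Definition _ := Lmodule_isNormed.Build R (ell2 R)
  ell2_ler_normD ell2_normZ ell2_norm_eq0.

Definition ell1 : set (ell2 R) := [set x : ell2 R | abs_summable x].

(* Every absolutely summable sequence underlies an element of [ell1]. *)
Lemma range_ell1 : [set ell2_val x | x in ell1] = [set u | abs_summable u].
Proof.
apply/seteqP; split=> [_ [x sx <-] //|u su].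
have u2 : u \in @ell2_pred R by rewrite inE; exact: abs_summable_square.
by exists (Ell2 u2).
Qed.

Definition ell1_plus : set (ell2 R) :=
  [set x : ell2 R | (forall n, 0 <= x n) /\ cvgn (series x)].

Lemma harmonic_ell2 : harmonic \in @ell2_pred R.
Proof. by rewrite inE; exact: square_summable_harmonic. Qed.

(* $n^{-1}$ for $n \geq 1$: [harmonic n] is [n.+1%:R^-1]. *)
Definition xbar : ell2 R := Ell2 harmonic_ell2.

End Ell2.

Arguments ell1 : clear implicits.
Arguments ell1_plus : clear implicits.
Arguments xbar : clear implicits.

(* Main.v *)
From HB Require Import structures.
Require Import Defs.
From mathcomp Require Import all_boot all_order all_algebra.
From mathcomp Require Import all_classical all_reals all_analysis.
From mathcomp Require Import ring lra.
Import Order.TTheory GRing.Theory Num.Theory.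
Import numFieldNormedType.Exports.
Local Open Scope classical_set_scope.
Local Open Scope ring_scope.

(** If a set [A] of [ell2] is stable under adding unit vectors, then the closed
    cone of [A - x] contains all of them; once it also contains their opposites
    (automatic when it is a subspace) it is everything, finitely supported
    sequences being dense. This gives [qri = qi] for [D] and [C + D]. For
    [A = C + D] and [x = xbar] the opposites come from
    [trunc xbar N - xbar n *: unit_vec n], an element of [D] for large [N], hence
    of [A] (with [0 *: xbar] in [C]): minus [xbar], it tends to
    [- xbar n *: unit_vec n]. Yet [xbar = t *: xbar + d] with [d] in [qi D] would
    make [d = (1 - t) *: xbar] a positive multiple of the harmonic sequence,
    which is not summable. *)

(** * Closures, convex sets and conic hulls in a normed space *)

Section ConvexCones.
Context {R : realType} {V : normedModType R}.
Implicit Types (A : set V) (x y : V).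

Lemma closure_normP A x :
  closure A x <-> forall e : R, 0 < e -> exists2 a, A a & `|x - a| < e.
Proof.
split=> [clA e e0|clA B /nbhs_normP [e /= e0 eB]].
  have [|a [Aa /= xa]] := clA [set y | `|x - y| < e]; last by exists a.
  by apply/nbhs_normP; exists e.
by have [a Aa xa] := clA _ e0; exists a; split=> //; exact: eB.
Qed.

Lemma closure_add_closed A : (forall x y, A x -> A y -> A (x + y)) ->
  forall x y, closure A x -> closure A y -> closure A (x + y).
Proof.
move=> AD x y /closure_normP clx /closure_normP cly.
apply/closure_normP => e e0; have e20 : 0 < e / 2 by lra.
have [[a Aa xa] [b Ab yb]] := (clx _ e20, cly _ e20).
exists (a + b); first exact: AD.
have -> : x + y - (a + b) = (x - a) + (y - b) by rewrite opprD addrACA.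
have := ler_normD (x - a) (y - b); lra.
Qed.

Lemma closure_scale_closed A (t : R) : (forall x, A x -> A (t *: x)) ->
  forall x, closure A x -> closure A (t *: x).
Proof.
move=> AZ x /closure_normP clx; apply/closure_normP => e e0.
(* The [+ 1] keeps the divisor positive when [t = 0]. *)
have d0 : 0 < `|t| + 1 by rewrite ltr_wpDl.
have [|a Aa xa] := clx (e / (`|t| + 1)); first by rewrite divr_gt0.
exists (t *: a); first exact: AZ.
rewrite -scalerBr normrZ.
apply: le_lt_trans (_ : (`|t| + 1) * `|x - a| < e).
  by rewrite ler_wpM2r // lerDl.
by rewrite mulrC -ltr_pdivlMr.
Qed.

Lemma closure_linear_subspace A :
  linear_subspace A -> linear_subspace (closure A).
Proof.
case; rewrite inE => A0 Alin.
have AD x y : A x -> A y -> A (x + y).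
  by move=> Ax Ay; rewrite -[x]scale1r; apply/set_mem/Alin; rewrite inE.
have AZ t x : A x -> A (t *: x).
  by move=> Ax; rewrite -[_ *: _]addr0; apply/set_mem/Alin; rewrite inE.
split; first by rewrite inE; exact: subset_closure.
move=> t x y; rewrite !inE => clx cly.
by apply: closure_add_closed => //; apply: closure_scale_closed => // ?; exact: AZ.
Qed.

Lemma convex_setP A : convex_set A <->
  forall x y (t : R), 0 <= t -> t <= 1 -> A x -> A y ->
    A (t *: x + (1 - t) *: y).
Proof.
split=> [cA x y t t0 t1 Ax Ay|cA x y l].
  by have := cA x y (Itv01 t0 t1); rewrite !inE; exact.
by rewrite !inE; apply: cA; [exact: ge0|exact: le1].
Qed.

Lemma mem_cone A x : A x -> cone A x.
Proof.
move=> Ax; right; exists 1; first by rewrite /= in_itv /= ler01.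
by exists x => //; rewrite scale1r.
Qed.

Lemma cone_scale A (s : R) x : 0 <= s -> cone A x -> cone A (s *: x).
Proof.
move=> s0 [->|[t]]; first by left; rewrite scaler0.
rewrite /= in_itv /= andbT => t0 [a Aa <-]; right.
exists (s * t); first by rewrite /= in_itv /= mulr_ge0.
by exists a => //; rewrite scalerA.
Qed.

(** [s *: a + t *: b] is [s + t] times the convex combination of [a] and [b] with weight
    [s / (s + t)]; the case [s = 0] is split off so that this quotient makes sense. *)
Lemma convex_cone_add A : convex_set A ->
  forall x y, cone A x -> cone A y -> cone A (x + y).
Proof.
move=> /convex_setP cA x y [->|[s + [a Aa <-]]]; first by rewrite add0r.
move=> /= /[!in_itv] /= /[!andbT] s0.
case=> [->|[t + [b Ab <-]]].
  by rewrite addr0 => *; apply: cone_scale => //; exact: mem_cone.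
move=> /= /[!in_itv] /= /[!andbT] t0.
have [s1|s1] := eqVneq s 0.
  by rewrite s1 scale0r add0r; apply: cone_scale => //; exact: mem_cone.
have s'0 : 0 < s by rewrite lt_neqAle eq_sym s1.
have st0 : 0 < s + t by lra.
have -> : s *: a + t *: b =
    (s + t) *: ((s / (s + t)) *: a + (1 - s / (s + t)) *: b).
  rewrite scalerDr !scalerA; congr (_ *: _ + _ *: _); field; lra.
apply: cone_scale; first exact: ltW.
apply/mem_cone/cA => //; first by rewrite divr_ge0 // ltW.
by rewrite ler_pdivrMr // mul1r lerDl.
Qed.

Lemma convex_translate A x : convex_set A -> convex_set [set a - x | a in A].
Proof.
move=> /convex_setP cA; apply/convex_setP => _ _ t t0 t1 [a Aa <-] [b Ab <-].
exists (t *: a + (1 - t) *: b); first exact: cA.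
by rewrite !scalerBr addrACA -opprD -scalerDl (addrC t) subrK scale1r.
Qed.

Lemma linear_subspaceT : linear_subspace [set: V].
Proof. by split=> [|t x y _ _]; rewrite inE. Qed.

Lemma qi_sub_qri A : qi A `<=` qri A.
Proof. by move=> x [Ax clA]; split=> //; rewrite clA; exact: linear_subspaceT. Qed.

(* If a linear functional attains its minimum over [A] at a point of [qri A],
   then the closed cone, being a subspace, lies in its kernel. *)
Lemma qri_supporting A x (f : {scalar V}) (M : R) :
  (forall y, `|f y| <= M * `|y|) ->
  qri A x -> (forall a, A a -> f x <= f a) -> forall a, A a -> f a = f x.
Proof.
move=> fM [Ax [clA0 clA]] fmin a Aa; apply/eqP.
rewrite eq_le fmin // andbT leNgt; apply/negP => fxa.
(* A negative [M] would force [f (a - x) = 0], against [f x < f a]. *)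
have M0 : 0 <= M.
  rewrite leNgt; apply/negP => M0; have := fM (a - x); rewrite linearB => h.
  have h2 : 0 < `|f a - f x| by rewrite normr_gt0; lra.
  have := normr_ge0 (a - x); nra.
have conef y : cone [set a - x | a in A] y -> 0 <= f y.
  case=> [->|[t + [_ [b Ab <-] <-]]].
    by rewrite linear0.
  by rewrite /= in_itv /= andbT linearZ linearB => t0; rewrite mulr_ge0 // subr_ge0 fmin.
have axcl : a - x \in closure (cone [set a - x | a in A]).
  by rewrite inE; apply/subset_closure/mem_cone; exists a.
(* A subspace also contains [x - a], where [f] is negative. Within distance [(f a - f x) / (M + 1)]
   the value of [f] moves by less than [f a - f x], so a nearby cone element would have a negative
   value too. *)
have /set_mem/closure_normP := clA (-1) _ _ axcl clA0; rewrite addr0 => clN.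
have [|b /conef fb] := clN ((f a - f x) / (M + 1)); first by rewrite divr_gt0; lra.
rewrite ltr_pdivlMr; last lra.
have := fM (-1 *: (a - x) - b); rewrite linearB linearZ linearB /= /GRing.scale /=.
have := ler_norm (- (-1 * (f a - f x) - f b)); rewrite normrN.
have := normr_ge0 (-1 *: (a - x) - b); lra.
Qed.

End ConvexCones.

(** * Coordinates, truncations and unit vectors in [ell2] *)

Section CoordinateVectors.
Context {R : realType}.
Implicit Types (u : R^nat) (x y : ell2 R) (A : set (ell2 R)).

Lemma series_finite_support u (N : nat) : (forall n, (N <= n)%N -> u n = 0) ->
  series u @ \oo --> series u N.
Proof.
move=> u0; apply: cvg_near_cst; exists N => // n /= Nn.
rewrite /series /= (big_cat_nat (leq0n N) Nn) /= [X in _ + X]big_nat_cond.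
by rewrite [X in _ + X]big1 ?addr0 // => i; rewrite andbT => /andP[/u0].
Qed.

Definition trunc_seq u (N : nat) : R^nat := fun n => if (n < N)%N then u n else 0.

Lemma trunc_seq_square_summable u (N : nat) : trunc_seq u N \in @ell2_pred R.
Proof.
rewrite inE; apply/cvg_ex; eexists; apply: (@series_finite_support _ N) => n Nn.
by rewrite /trunc_seq ltnNge Nn expr0n.
Qed.

Definition trunc x N : ell2 R := Ell2 (trunc_seq_square_summable x N).

Lemma unit_seq_square_summable n :
  (fun k => (k == n)%:R : R) \in @ell2_pred R.
Proof.
rewrite inE; apply/cvg_ex; eexists; apply: (@series_finite_support _ n.+1) => k nk.
by rewrite gtn_eqF // expr0n.
Qed.

Definition unit_vec n : ell2 R := Ell2 (unit_seq_square_summable n).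

Lemma ell2E x y : (forall n, x n = y n) -> x = y.
Proof. by move=> xy; apply/val_inj/funext. Qed.

Lemma truncS x N : trunc x N.+1 = trunc x N + x N *: unit_vec N.
Proof.
apply: ell2E => n; rewrite /= /trunc_seq ltnS leq_eqVlt.
change ((if (n == N) || (n < N)%N then x n else 0) =
  (if (n < N)%N then x n else 0) + x N * (n == N)%:R).
by case: eqVneq => [->|_] /=; rewrite ?ltnn ?mulr1 ?mulr0 ?add0r ?addr0.
Qed.

Lemma trunc0 x : trunc x 0 = 0.
Proof. exact: ell2E. Qed.

Lemma ler_norm_coord x n : `|x n| <= `|x|.
Proof.
rewrite -(@ler_pXn2r _ 2) ?nnegrE //.
change (`|x n| ^+ 2 <= ell2_norm x ^+ 2).
rewrite ell2_norm_sqr real_normK ?num_real //.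
apply: le_trans (ell2_series_le x n.+1).
by rewrite seriesSr lerDr sumr_ge0 // => i _; exact: sqr_ge0.
Qed.

Lemma norm_tail_small x (e : R) : 0 < e ->
  exists N, forall n, (N <= n)%N -> `|x - trunc x n| < e.
Proof.
move=> e0; have /cvgrPdist_lt/(_ (e ^+ 2)) := @ell2_cvg R x.
case; first by rewrite exprn_gt0.
move=> N _ NP; exists N => n Nn; have {NP} := NP n Nn.
set L := limn _ => Ln.
rewrite -(@ltr_pXn2r _ 2) ?nnegrE ?(ltW e0) //.
change (ell2_norm (x - trunc x n) ^+ 2 < e ^+ 2).
rewrite ell2_norm_sqr; apply: le_lt_trans Ln.
apply: le_trans (ler_norm _).
(* For [m >= n], the [m]-th partial sum for [x - trunc x n] collects the squares of [x] from [n] to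
   [m], hence is at most [L] minus the [n]-th partial sum. *)
apply: limr_le; first exact: ell2_cvg.
exists n => // m /= nm; rewrite lerBrDr.
apply: le_trans (ell2_series_le x m).
rewrite /series /= !(big_cat_nat (leq0n n) nm) /=.
rewrite [X in X + _ + _ <= _]big_nat_cond big1 => [|i]; last first.
  rewrite andbT => /andP[_ ni].
  change ((x i - (if (i < n)%N then x i else 0)) ^+ 2 = 0).
  by rewrite ni subrr expr0n.
rewrite add0r addrC lerD2r ler_sum_nat // => i /andP[ni _].
change ((x i - (if (i < n)%N then x i else 0)) ^+ 2 <= x i ^+ 2).
by rewrite ltnNge ni subr0.
Qed.

(* Finite combinations of the unit vectors are dense. *)
Lemma convex_cone_total A : (forall x y, A x -> A y -> A (x + y)) ->
  (forall x (t : R), 0 <= t -> A x -> A (t *: x)) -> closed A ->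
  (forall n, A (unit_vec n)) -> (forall n, A (- unit_vec n)) -> A = setT.
Proof.
move=> AD AZ /closure_id clA Ae ANe.
have AeZ n (t : R) : A (t *: unit_vec n).
  have [/AZ|/ltW t0] := leP 0 t; first by exact.
  by rewrite -[t]opprK scaleNr -scalerN; apply: AZ => //; rewrite oppr_ge0.
rewrite -subTset => x _; rewrite clA; apply/closure_normP => e e0.
have [N Nx] := norm_tail_small x _ e0; exists (trunc x N); last exact: Nx.
elim: {Nx} N => [|N IH]; last by rewrite truncS; exact: AD.
by rewrite trunc0 -[0](scale0r (unit_vec 0)).
Qed.

Lemma unit_vec_cone A x n : A (x + unit_vec n) ->
  cone [set a - x | a in A] (unit_vec n).
Proof.
by move=> Axn; apply: mem_cone; exists (x + unit_vec n); rewrite // addrC addKr.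
Qed.

Lemma qri_eq_qi A : (forall x n, A x -> A (x + unit_vec n)) -> qri A = qi A.
Proof.
move=> Ae; apply/seteqP; split; last exact: qi_sub_qri.
move=> x [Ax [cl0 cl]]; split=> //; set K := closure _ in cl0 cl *.
have Ke n : K (unit_vec n) by apply/subset_closure/unit_vec_cone/Ae.
have KD (t : R) y z : K y -> K z -> K (t *: y + z).
  by move=> Ky Kz; apply/set_mem/cl; rewrite inE.
have K0 : K 0 by rewrite inE in cl0.
apply: convex_cone_total => [y z Ky Kz|y t _ Ky| |//|n].
- by rewrite -[y]scale1r; exact: KD.
- by rewrite -[_ *: _]addr0; exact: KD.
- exact: closed_closure.
- by rewrite -scaleN1r -[_ *: _]addr0; exact: KD.
Qed.

(** Convexity takes over from the subspace property: it makes the closed cone stable under addition,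
    so only the opposites of the unit vectors have to be supplied. *)
Lemma convex_qi A x : convex_set A -> A x ->
  (forall n, A (x + unit_vec n)) ->
  (forall n, closure (cone [set a - x | a in A]) (- unit_vec n)) -> qi A x.
Proof.
move=> cA Ax Ae ANe; split=> //; apply: convex_cone_total => //.
- by apply/closure_add_closed/convex_cone_add/convex_translate.
- by move=> y t t0; apply/closure_scale_closed => z; exact: cone_scale.
- exact: closed_closure.
- by move=> n; apply/subset_closure/unit_vec_cone.
Qed.

(** Named so that it can carry a linear structure and serve as the functional in [qri_supporting]
    and [qri_segment]. *)
Definition coord (n : nat) x : R := x n.

Fact coord_linear n : linear_for *%R (coord n).
Proof. by []. Qed.

HB.instance Definition _ n :=
  GRing.isLinear.Build R (ell2 R) R *%R (coord n) (coord_linear n).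

End CoordinateVectors.

(** * Quasi relative interior and intrinsic core of the segment from 0 to [v] *)

Section Segments.
Context {R : realType} {V : normedModType R} (v : V).

Let S : set V := [set t *: v | t in `[0, 1]].

Lemma convex_segment : convex_set S.
Proof.
apply/convex_setP => _ _ t t0 t1 [a + <-] [b + <-].
rewrite /= !in_itv /= => /andP[a0 a1] /andP[b0 b1].
exists (t * a + (1 - t) * b); last by rewrite !scalerA scalerDl.
have t1' : 0 <= 1 - t by rewrite subr_ge0.
rewrite /= in_itv /= addr_ge0 ?mulr_ge0 //=.
by rewrite -[leRHS](subrKC t) lerD // -[leRHS]mulr1 ler_wpM2l.
Qed.

(** Seen from [t *: v], the ends [v] and [0] lie in opposite directions, so the cone is already the
    whole line through [v], a subspace, and its closure is one as well. *)
Lemma open_segment_sub_qri t : 0 < t -> t < 1 -> qri S (t *: v).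
Proof.
move=> t0 t1; split; first by exists t => //=; rewrite in_itv /= !ltW.
apply: closure_linear_subspace.
suff -> : cone [set a - t *: v | a in S] = [set s *: v | s in setT].
  split=> [|a x y]; rewrite !inE; first by exists 0; last by rewrite scale0r.
  by move=> [b _ <-] [c _ <-]; exists (a * b + c); rewrite // scalerA scalerDl.
apply/seteqP; split=> [x|x].
  case=> [->|[s _ [_ [_ [u _ <-] <-] <-]]]; first by exists 0; last by rewrite scale0r.
  by exists (s * (u - t)); rewrite // -scalerA scalerBl.
move=> [s _ <-]; have [s0|s0] := leP 0 s.
  have -> : s *: v = (s / (1 - t)) *: (1 *: v - t *: v).
    by rewrite -scalerBl scalerA divfK // gt_eqF // subr_gt0.
  apply: cone_scale; first by rewrite divr_ge0 // ltW // subr_gt0.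
  by apply: mem_cone; exists (1 *: v) => //; exists 1; rewrite //= in_itv /= ler01 lexx.
have -> : s *: v = (- s / t) *: (0 *: v - t *: v).
  by rewrite -scalerBl scalerA sub0r mulrN !mulNr opprK divfK // gt_eqF.
apply: cone_scale; first by rewrite divr_ge0 // ltW // oppr_gt0.
by apply: mem_cone; exists (0 *: v) => //; exists 0; rewrite //= in_itv /= ler01 lexx.
Qed.

Lemma aff_segment : aff S = [set s *: v | s in setT].
Proof.
apply/seteqP; split=> [|_ [s _ <-] B [Baff SB]].
  apply: smallest_sub => [_ _ t [a _ <-] [b _ <-]|_ [t _ <-]]; last by exists t.
  by exists ((1 - t) * a + t * b); rewrite // !scalerA scalerDl.
have S0 : S 0 by exists 0; rewrite ?scale0r //= in_itv /= ler01 lexx.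
have S1 : S v by exists 1; rewrite ?scale1r //= in_itv /= ler01 lexx.
by have := Baff _ _ s (SB _ S0) (SB _ S1); rewrite scaler0 add0r.
Qed.

Lemma icr_segment : v != 0 -> icr S = [set t *: v | t in `]0, 1[].
Proof.
move=> v0; apply/seteqP; split=> [_ [[t t01 <-] tP]|_ [t + <-]].
  exists t => //; move: t01; rewrite /= !in_itv /= => /andP[t0 t1].
  have S_ s : S (s *: v) -> 0 <= s <= 1.
    case=> r + /eqP; rewrite -subr_eq0 -scalerBl scaler_eq0 (negPf v0) orbF subr_eq0.
    by move=> /= /[!in_itv] /= r01 /eqP <-.
  rewrite !lt_neqAle t0 t1 !andbT; apply/andP; split; apply/eqP => tE.
    (* At [t = 0] any move towards [- v] leaves the segment; at [t = 1] a move towards [2 *: v]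
       does. *)
    have [|d d0] := tP ((-1) *: v); first by rewrite aff_segment; exists (-1).
    move=> /(_ d); rewrite lexx ltW // => /(_ isT).
    by rewrite -scalerBl scalerA -scalerDl => /S_/andP[]; nra.
  have [|d d0] := tP (2 *: v); first by rewrite aff_segment; exists 2.
  move=> /(_ d); rewrite lexx ltW // => /(_ isT).
  by rewrite -scalerBl scalerA -scalerDl => /S_/andP[]; nra.
rewrite /= in_itv /= => /andP[t0 t1].
split; first by exists t => //=; rewrite in_itv /= !ltW.
move=> y; rewrite aff_segment => -[s _ <-].
(* [m] is the distance from [t] to the nearer end of the unit interval, and [d] is chosen so that
   [r * (s - t)] stays within [m] for [r <= d]. *)
pose m := Num.min t (1 - t); pose d := m / (`|s - t| + 1).
have m0 : 0 < m by rewrite lt_min t0 subr_gt0.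
have n0 : 0 < `|s - t| + 1 by rewrite ltr_wpDl.
exists d; first by rewrite divr_gt0.
move=> r /andP[r0 rd]; rewrite -scalerBl scalerA -scalerDl.
have : `|r * (s - t)| <= m.
  rewrite normrM (ger0_norm r0).
  have : r * (`|s - t| + 1) <= m by rewrite -ler_pdivlMr.
  lra.
rewrite ler_norml => /andP[].
have mt : m <= t by rewrite ge_min lexx.
have mt1 : m <= 1 - t by rewrite ge_min lexx orbT.
move=> h1 h2; exists (t + r * (s - t)) => //=.
by rewrite in_itv /=; apply/andP; split; lra.
Qed.

(** The functional [f] reads off the parameter [t]. At [0] it is minimal over the segment and at [v]
    its opposite is, so [qri_supporting] would make it constant there, though it takes both values 0
    and 1. *)
Lemma qri_segment (f : {scalar V}) (M : R) : (forall y, `|f y| <= M * `|y|) ->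
  f v = 1 -> qri S = [set t *: v | t in `]0, 1[].
Proof.
move=> fM fv; apply/seteqP; split; last first.
  move=> _ [t + <-]; rewrite /= in_itv /= => /andP[t0 t1].
  exact: open_segment_sub_qri.
move=> _ /[dup] [[[t + <-] _]] qt; rewrite /= !in_itv /= => /andP[t0 t1].
exists t => //=; rewrite in_itv /= !lt_neqAle t0 t1 !andbT.
have fZ s : f (s *: v) = s by rewrite linearZ fv /= /GRing.scale /= mulr1.
have S0 : S (0 *: v) by exists 0; rewrite //= in_itv /= ler01 lexx.
have S1 : S (1 *: v) by exists 1; rewrite //= in_itv /= ler01 lexx.
apply/andP; split; apply/eqP => tE.
  have /(_ _ S1) : forall a, S a -> f a = f (t *: v).
    apply: qri_supporting fM qt _ => _ [s + <-].
    by rewrite /= in_itv /= !fZ -tE => /andP[].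
  by rewrite !fZ -tE => /eqP; rewrite oner_eq0.
have /(_ _ S0) : forall a, S a -> (\- f) a = (\- f) (t *: v).
  apply: (@qri_supporting _ _ _ _ (\- f) M) qt _ => [y|_ [s + <-]].
    by rewrite /= normrN.
  by rewrite /= in_itv /= !fZ tE lerN2 => /andP[].
by rewrite /= !fZ tE => /eqP; rewrite eqr_opp eq_sym oner_eq0.
Qed.

End Segments.

(** * The cone [ell1_plus] of nonnegative summable sequences *)

Section PositiveCone.
Context {R : realType}.
Implicit Types x y : ell2 R.

Lemma ell1_plusD x y : ell1_plus R x -> ell1_plus R y -> ell1_plus R (x + y).
Proof.
move=> [x0 cx] [y0 cy]; split; last exact: is_cvg_seriesD.
by move=> n; exact: addr_ge0 (x0 n) (y0 n).
Qed.

Lemma ell1_plusZ (t : R) x : 0 <= t -> ell1_plus R x -> ell1_plus R (t *: x).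
Proof.
move=> t0 [x0 cx]; split; last exact: is_cvg_seriesZ.
by move=> n; exact: mulr_ge0 t0 (x0 n).
Qed.

Lemma convex_ell1_plus : convex_set (ell1_plus R).
Proof.
by apply/convex_setP => x y t t0 t1 *; apply: ell1_plusD;
  apply: ell1_plusZ; rewrite // subr_ge0.
Qed.

Lemma ell1_plus_finite_support x (N : nat) : (forall n, 0 <= x n) ->
  (forall n, (N <= n)%N -> x n = 0) -> ell1_plus R x.
Proof.
move=> x0 xN; split=> //.
by apply/cvg_ex; eexists; exact: (@series_finite_support _ _ N).
Qed.

Lemma ell1_plus_unit_vec n : ell1_plus R (unit_vec n).
Proof.
apply: (@ell1_plus_finite_support _ n.+1) => [k /=|k nk /=]; first exact: ler0n.
by rewrite gtn_eqF.
Qed.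

Lemma ell1_plusE x : ell1_plus R x <-> ell1 R x /\ forall n, 0 <= x n.
Proof.
have absE : (forall n, 0 <= x n) -> (fun n => `|x n|) = x.
  by move=> x0; apply/funext => n; exact: ger0_norm.
rewrite /ell1 /ell1_plus /abs_summable /=.
by split=> -[]; [move=> x0|move=> + x0]; rewrite (absE x0).
Qed.

Lemma qri_ell1_plus : qri (ell1_plus R) = qi (ell1_plus R).
Proof.
apply: qri_eq_qi => x n Dx; apply: ell1_plusD => //; exact: ell1_plus_unit_vec.
Qed.

(** If [x n = 0], then [coord n] is minimal at [x], hence constant on the cone, yet it is 1 at
    [unit_vec n]. If [x n > 0], subtracting [x n *: unit_vec n] from [x] stays in the cone and
    yields the direction [- unit_vec n]. *)
Lemma qi_ell1_plus :
  qi (ell1_plus R) = [set x | ell1 R x /\ forall n, 0 < x n].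
Proof.
apply/seteqP; split=> [x /[dup] [[Dx _]] /qi_sub_qri qx|x [x1 x0]].
  have [sx x0] := (ell1_plusE x).1 Dx.
  split=> // n; rewrite lt_neqAle x0 andbT; apply/eqP => xn.
  have /(_ _ (ell1_plus_unit_vec n)) : forall a, ell1_plus R a ->
      coord n a = coord n x.
    apply: (@qri_supporting _ _ _ _ (coord n) 1) qx _ => [y|a [a0 _]].
      by rewrite mul1r; exact: ler_norm_coord.
    by change (x n <= a n); rewrite -xn.
  change ((n == n)%:R = x n -> False); by rewrite -xn eqxx => /eqP; rewrite oner_eq0.
have Dx : ell1_plus R x by apply/ell1_plusE; split=> // n; exact: ltW.
apply: convex_qi => // [|n|n]; first exact: convex_ell1_plus.
  by apply: ell1_plusD => //; exact: ell1_plus_unit_vec.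
apply: subset_closure.
have -> : - unit_vec n = (x n)^-1 *: ((x - x n *: unit_vec n) - x).
  by rewrite addrC addKr scalerN scalerA mulVf ?scale1r // gt_eqF.
apply: cone_scale; first by rewrite invr_ge0 ltW.
apply: mem_cone; exists (x - x n *: unit_vec n) => //; split; last first.
  rewrite -scaleNr; apply: is_cvg_seriesD; first by case: Dx.
  by apply: is_cvg_seriesZ; case: (ell1_plus_unit_vec n).
move=> k; change (0 <= x k - x n * (k == n)%:R).
by case: eqVneq => [->|_]; rewrite ?mulr1 ?subrr // mulr0 subr0 ltW.
Qed.

End PositiveCone.

(** * The sum of [C] and [D] at the point [xbar] *)

Theorem mainTheorem2 (R : realType) :
  let C : set (ell2 R) := [set t *: xbar R | t in `[0, 1]] in
  let D : set (ell2 R) := ell1_plus R in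
  convex_set C /\
  convex_set D /\
  (qri C = icr C /\ icr C = [set t *: xbar R | t in `]0, 1[]) /\
  (qri D = qi D /\ qi D = [set x | ell1 R x /\ forall n, 0 < x n]) /\
  (qi (sumset C D) (xbar R) /\ qi (sumset C D) = qri (sumset C D)) /\
  ~ sumset C (qi D) (xbar R) /\
  sumset (qri C) (qri D) `<=` sumset C (qi D).
Proof.
move=> C D.
have xbar0 : xbar R 0%N = 1 by rewrite /= /harmonic invr1.
have xbar_neq0 : xbar R != 0.
  by apply/eqP => x0; move: xbar0; rewrite x0 => /esym/eqP; rewrite oner_eq0.
have icrC := @icr_segment _ _ _ xbar_neq0.
have qriC : qri C = [set t *: xbar R | t in `]0, 1[].
  apply: (@qri_segment _ _ (xbar R) (coord 0) 1 _ xbar0) => y.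
  by rewrite mul1r; exact: ler_norm_coord.
have cC : convex_set C by exact: convex_segment.
have CDe x n : sumset C D x -> sumset C D (x + unit_vec n).
  move=> [a Ca [d Dd <-]]; exists a => //; exists (d + unit_vec n).
    by apply: ell1_plusD => //; exact: ell1_plus_unit_vec.
  by rewrite addrA.
split=> //; split; first exact: convex_ell1_plus.
split; first by rewrite qriC icrC.
split; first by rewrite qri_ell1_plus; split=> //; exact: qi_ell1_plus.
split; first split.
- have CDx : sumset C D (xbar R).
    exists (1 *: xbar R); first by exists 1; rewrite //= in_itv /= ler01 lexx.
    exists 0; last by rewrite scale1r addr0.
    exact: (@ell1_plus_finite_support _ _ 0).
  apply: convex_qi => // [|n|n]; last 1 first.
  + have -> : - unit_vec n = (xbar R n)^-1 *: (- (xbar R n *: unit_vec n)).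
      by rewrite scalerN scalerA mulVf ?scale1r // gt_eqF // harmonic_gt0.
    apply: closure_scale_closed.
      by move=> x; apply: cone_scale; rewrite invr_ge0 harmonic_ge0.
    apply/closure_normP => e e0.
    have [N Nx] := norm_tail_small (xbar R) _ e0.
    (* [M >= N] makes the truncation error smaller than [e]; [M > n] keeps coordinate [n] in the
       truncation, so that subtracting [xbar n] there leaves 0 and not a negative number. *)
    set M := maxn N n.+1.
    exists ((trunc (xbar R) M - xbar R n *: unit_vec n) - xbar R); last first.
      by rewrite !opprB addrCA addKr Nx // leq_maxl.
    apply: mem_cone; exists (trunc (xbar R) M - xbar R n *: unit_vec n) => //.
    exists (0 *: xbar R); first by exists 0; rewrite //= in_itv /= ler01 lexx.
    exists (trunc (xbar R) M - xbar R n *: unit_vec n); last first.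
      by rewrite scale0r add0r.
    have dE k : (trunc (xbar R) M - xbar R n *: unit_vec n) k =
      (if (k < M)%N then xbar R k else 0) - xbar R n * (k == n)%:R by [].
    have nM : (n < M)%N by rewrite leq_maxr.
    apply: (@ell1_plus_finite_support _ _ M) => k; rewrite dE.
      case: eqVneq => [->|_]; first by rewrite nM mulr1 subrr.
      by rewrite mulr0 subr0; case: ifP => // _; exact: harmonic_ge0.
    by move=> Mk; rewrite ltnNge Mk gtn_eqF ?(leq_trans nM) // mulr0 subr0.
  + apply/convex_setP => _ _ t t0 t1 [a Ca [b Db <-]] [c Cc [d Dd <-]].
    rewrite !scalerDr addrACA; exists (t *: a + (1 - t) *: c).
      exact: (convex_setP _).1.
    exists (t *: b + (1 - t) *: d) => //.
    exact: (convex_setP _).1 convex_ell1_plus _ _ _ _ _ _ _.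
  + exact: CDe.
- by rewrite (qri_eq_qi _ CDe).
split; last first.
  by rewrite qri_ell1_plus => _ [c [Cc _] [d Dd <-]]; exists c => //; exists d.
move=> [_ [t _ <-] [d]]; rewrite qi_ell1_plus => -[sd d0] xE.
have dE : d = (1 - t) *: xbar R by rewrite scalerBl scale1r -{1}xE addrC addKr.
(* The value [t = 1] is excluded by the strict positivity of [d], read at index 0, where [xbar] is
   1. *)
have t1 : 0 < 1 - t.
  have := d0 0%N; rewrite dE.
  by change (0 < (1 - t) * xbar R 0%N -> 0 < 1 - t); rewrite xbar0 mulr1.
have [_] : D d by apply/ell1_plusE; split=> // n; exact: ltW.
(* Dividing the summable [d] by [1 - t] would make the harmonic series converge. *)
move=> /(@is_cvg_seriesZ _ _ (1 - t)^-1).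
have -> : (1 - t)^-1 *: (d : R^nat) = harmonic.
  apply/funext => n; rewrite dE.
  change ((1 - t)^-1 * ((1 - t) * xbar R n) = harmonic n).
  by rewrite mulKf // gt_eqF.
exact: dvg_harmonic.
Qed.
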